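(* Suppose that $b$ satisfies assumptions (A1)–(A4) of the context. Then the process $Y$ solving $$Y_t = Y_0+\int_0^t b(s,Y_s)\,ds+Z_t$$ (the local solution described in the context) satisfies $$Y_t>\varphi(t),\qquad t\in[0,T],$$ and therefore the equation has a unique solution on the entire interval $[0,T]$.
   Context: Fix $T\in(0,\infty)$ and $\lambda\in(0,1)$. Let $\varphi:[0,T]\to\mathbb R$ be $\lambda$-Hölder continuous. For $a\ge 0$ let $\mathcal D_a := \{(t,y) : t\in[0,T],\ y\in(\varphi(t)+a,\infty)\}$. The initial value $Y_0$ is a deterministic constant with $Y_0>\varphi(0)$. The noise $Z=\{Z_t,\ t\in[0,T]\}$ is a stochastic process such that $Z_0=0$ a.s. and there is a random variable $\Lambda=\Lambda(\omega)\in(0,\infty)$ with $|Z_t-Z_s|\le\Lambda|t-s|^\lambda$ for all $t,s\in[0,T]$. All equations are understood pathwise. Assumptions on the drift $b$: (A1) $b:\mathcal D_0\to\mathbb R$ is continuous. (A2) For any $\varepsilon>0$ there is a constant $c_\varepsilon>0$ such that $|b(t,y_1)-b(t,y_2)|\le c_\varepsilon|y_1-y_2|$ for all $(t,y_1),(t,y_2)\in\mathcal D_\varepsilon$. (A3) There are positive constants $y_*$, $c$, $\gamma$ such that $b(t,y)\ge \frac{c}{(y-\varphi(t))^\gamma}$ for all $(t,y)\in\mathcal D_0\setminus\mathcal D_{y_*}$. (A4) The constant $\gamma$ from (A3) satisfies $\gamma>\frac{1-\lambda}{\lambda}$. Local solution: under (A1)–(A3) there is a continuous process $Y=\{Y_t,\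 t\in[0,T]\}$ satisfying the equation for all $t\in[0,\tau_0]$, where $\tau_0:=\inf\{t\in[0,T] : Y_t=\varphi(t)\}\wedge T$, and it is uniquely determined on $[0,\tau_0]$. *)

(* Defs.v *)
From HB Require Import structures.
From mathcomp Require Import all_boot all_order all_algebra.
From mathcomp Require Import all_classical all_reals all_analysis.

Set Implicit Arguments.
Unset Strict Implicit.
Unset Printing Implicit Defensive.

Import Order.TTheory GRing.Theory Num.Theory.
Import numFieldNormedType.Exports.

Local Open Scope classical_set_scope.
Local Open Scope ring_scope.

(* Functions on [0, T] (phi, the sample paths) and functions on D_0 (the drift)
   are represented by total functions; every condition below constrains them
   only on [0, T], resp. on D_0. *)

Definition hoelder_bound (R : realType) (T lambda K : R) (f : R -> R) : Prop :=
  forall s t, 0 <= s <= T -> 0 <= t <= T ->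
    `|f t - f s| <= K * `|t - s| `^ lambda.

Definition hoelder_continuous (R : realType) (T lambda : R) (f : R -> R) : Prop :=
  exists K, hoelder_bound T lambda K f.

Definition dom (R : realType) (T : R) (phi : R -> R) (a : R) : set (R * R) :=
  [set p | 0 <= p.1 <= T /\ phi p.1 + a < p.2].

Definition drift_A1 (R : realType) (T : R) (phi : R -> R) (b : R * R -> R)
  : Prop :=
  {within dom T phi 0, continuous b}.

Definition drift_A2 (R : realType) (T : R) (phi : R -> R) (b : R * R -> R)
  : Prop :=
  forall eps, 0 < eps -> exists2 c_eps, 0 < c_eps &
    forall t y1 y2, dom T phi eps (t, y1) -> dom T phi eps (t, y2) ->
      `|b (t, y1) - b (t, y2)| <= c_eps * `|y1 - y2|.

Definition drift_A3 (R : realType) (T : R) (phi : R -> R) (b : R * R -> R)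
    (ystar c gamma : R) : Prop :=
  [/\ 0 < ystar, 0 < c, 0 < gamma &
    forall t y, (dom T phi 0 `\` dom T phi ystar) (t, y) ->
      c / (y - phi t) `^ gamma <= b (t, y)].

Definition drift_A4 (R : realType) (lambda gamma : R) : Prop :=
  (1 - lambda) / lambda < gamma.

Definition noise (R : realType) (d : measure_display) (Omega : measurableType d)
    (P : probability Omega R) (T lambda : R) (Z : R -> {RV P >-> R}) : Prop :=
  {ae P, forall w, Z 0 w = 0} /\
  exists2 Lambda : {RV P >-> R}, (forall w, 0 < Lambda w) &
    forall w, hoelder_bound T lambda (Lambda w) (fun t => Z t w).

(* The integral equation at time t for the paths y, z.  Integrability is part of
   the meaning of the equation: the library integral of a non-integrable
   function is a default value. *)
Definition equation_at (R : realType) (b : R * R -> R) (Y0 : R) (z y : R -> R)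
    (t : R) : Prop :=
  lebesgue_measure.-integrable `[0, t] (fun s => (b (s, y s))%:E) /\
  y t = Y0 + \int[lebesgue_measure]_(s in `[0, t]) b (s, y s) + z t.

(* The infimum is taken in \bar R, so that the infimum of the empty set is +oo
   (and not 0, as for the infimum in R). *)
Definition tau0 (R : realType) (T : R) (phi y : R -> R) : \bar R :=
  Order.min
    (ereal_inf [set t%:E | t in [set t | 0 <= t <= T /\ y t = phi t]]) T%:E.

Definition continuous_path (R : realType) (T : R) (y : R -> R) : Prop :=
  {within `[0, T], continuous y}.

Definition local_solution_path (R : realType) (T : R) (phi : R -> R)
    (b : R * R -> R) (Y0 : R) (z y : R -> R) : Prop :=
  continuous_path T y /\
  forall t, 0 <= t -> (t%:E <= tau0 T phi y)%E -> equation_at b Y0 z y t.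

(* A solution on all of [0, T] has its graph in D_0, where b is given. *)
Definition solution_path (R : realType) (T : R) (phi : R -> R)
    (b : R * R -> R) (Y0 : R) (z y : R -> R) : Prop :=
  continuous_path T y /\
  forall t, 0 <= t <= T -> dom T phi 0 (t, y t) /\ equation_at b Y0 z y t.

Definition local_solution (R : realType) (d : measure_display)
    (Omega : measurableType d) (P : probability Omega R) (T : R) (phi : R -> R)
    (b : R * R -> R) (Y0 : R) (Z Y : R -> {RV P >-> R}) : Prop :=
  {ae P, forall w,
    local_solution_path T phi b Y0 (fun t => Z t w) (fun t => Y t w)}.

Definition solution (R : realType) (d : measure_display)
    (Omega : measurableType d) (P : probability Omega R) (T : R) (phi : R -> R)
    (b : R * R -> R) (Y0 : R) (Z Y : R -> {RV P >-> R}) : Prop :=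
  {ae P, forall w,
    solution_path T phi b Y0 (fun t => Z t w) (fun t => Y t w)}.

Definition indistinguishable (R : realType) (d : measure_display)
    (Omega : measurableType d) (P : probability Omega R) (T : R)
    (Y Y' : R -> {RV P >-> R}) : Prop :=
  {ae P, forall w, forall t, 0 <= t <= T -> Y t w = Y' t w}.

(* Main.v *)
Require Import Defs.
From HB Require Import structures.
From mathcomp Require Import all_boot all_order all_algebra.
From mathcomp Require Import all_classical all_reals all_analysis.
From mathcomp Require Import measurable_realfun ring lra.

Set Implicit Arguments.
Unset Strict Implicit.
Unset Printing Implicit Defensive.

Import Order.TTheory GRing.Theory Num.Theory.
Import numFieldNormedType.Exports.

Local Open Scope classical_set_scope.
Local Open Scope ring_scope.

(** The solution cannot reach the barrier phi because the repulsion of the drift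
    is stronger there than the oscillation of the noise.  Let x = y - phi be the
    gap.  If x reached the level e, then between its last visit to 2 * e and that
    moment, say during a time D, it would lose e, while the drift would push it
    up at a rate of at least c / (2 e)^gamma and the Hoelder paths z and phi could
    lower it by at most K D^lambda; hence e + c / (2 e)^gamma D <= K D^lambda.
    This forces D to be at least of order e^(1 / lambda) and D^(1 - lambda) to be
    at most of order e^gamma, which is impossible for small e exactly because
    gamma > (1 - lambda) / lambda ([no_short_descent], [final_descent],
    [solution_gap]).  The argument uses the equation only at times up to which
    the gap stays above e, so it applies to a local solution as well as to a
    solution of an equation whose drift has been modified below phi + e.

    A solution on [0, T] is continuous on a compact interval, so its gap has a
    positive minimum and the drift is Lipschitz along it; uniqueness is then the
    Gronwall argument, carried out in the norm weighted by exp (- 2 L t), for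
    which the integral operator contracts by 1/2 ([Rintegral_exp_bound],
    [solution_path_unique]).

    For existence, the drift is frozen below phi + 1/(n+1), which makes it
    globally Lipschitz, and the resulting equation is solved by Picard iteration
    for every sample point.  The iterates are random variables because an
    integral of a continuous path is a limit of Riemann sums
    ([measurable_Rintegral], [picard_measurable]).  By the barrier argument the
    n-th solution stays above phi + 1/(n+1) when n is large, the threshold
    depending on the sample point; from then on it solves the original equation,
    and by uniqueness the sequence is eventually constant.  Its pointwise limit
    is therefore a measurable solution ([truncated_solution_lim_spec]). *)

(** * Increments of integrals *)

Section increments.
Context (R : realType).
Notation mu := (@lebesgue_measure R).

Lemma integrable_itv0S (g : R -> R) (s t : R) : s <= t ->
  mu.-integrable `[0, t] (EFin \o g) -> mu.-integrable `[0, s] (EFin \o g).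
Proof.
move=> st; apply: integrableS => //.
by apply: subset_itvl; rewrite bnd_simp.
Qed.

Lemma Rintegral_incr_ge (g : R -> R) (s t l : R) : 0 <= s -> s <= t ->
    mu.-integrable `[0, t] (EFin \o g) ->
    (forall r, s <= r <= t -> l <= g r) ->
  l * (t - s) <= \int[mu]_(r in `[0, t]) g r - \int[mu]_(r in `[0, s]) g r.
Proof.
move=> s0 st ig lg; rewrite (@Rintegral_itvB _ g) ?bnd_simp//.
have mE : fine (mu `]s, t]) = t - s.
  by rewrite lebesgue_measure_itv/= lte_fin; case: ltP => //= ts;
    apply/esym/eqP; rewrite subr_eq0 eq_le st ts.
rewrite -mE -Rintegral_cst//; apply: le_Rintegral => //.
- apply: measurable_bounded_integrable => //=.
  + by rewrite lebesgue_measure_itv/=; case: ifP => //; rewrite -EFinD ltry.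
  + exact: bounded_cst.
- by apply: integrableS ig => //; apply: subset_itv; rewrite bnd_simp.
- by move=> r /=; rewrite in_itv/= => /andP[sr rt]; apply: lg; rewrite (ltW sr).
Qed.

Lemma Rintegral_incr_le (g : R -> R) (s t l : R) : 0 <= s -> s <= t ->
    mu.-integrable `[0, t] (EFin \o g) ->
    (forall r, s <= r <= t -> g r <= l) ->
  \int[mu]_(r in `[0, t]) g r - \int[mu]_(r in `[0, s]) g r <= l * (t - s).
Proof.
move=> s0 st ig lg.
have iNg : mu.-integrable `[0, t] (EFin \o (fun x => - 1 * g x)).
  have := @integrableZl _ _ _ mu `[0, t] (measurable_itv _) (-1) _ ig.
  by apply: eq_integrable.
have := @Rintegral_incr_ge _ s t (- l) s0 st iNg.
rewrite !RintegralZl// ?(integrable_itv0S st)//.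
move=> /(_ _)/wrap[r srt|]; first by have := lg r srt; lra.
lra.
Qed.

End increments.

(** * Crossing a small level *)

Lemma powRVK (R : realType) (a p : R) : 0 <= a -> p != 0 ->
  (a `^ p^-1) `^ p = a.
Proof. by move=> a0 p0; rewrite -powRrM mulVf// powRr1. Qed.

(** If the inequality failed, then e <= K D^lambda would bound D from below by
    (e / K)^(1 / lambda), and c / (2 e)^gamma D <= K D^lambda would bound
    D^(1 - lambda) from above by a multiple of e^gamma.  Together they bound
    e^(gamma - (1 - lambda) / lambda) away from 0. *)
Lemma no_short_descent (R : realType) (K c gamma lambda : R) : 0 < K -> 0 < c ->
    0 < gamma -> 0 < lambda < 1 -> (1 - lambda) / lambda < gamma ->
  exists2 e0, 0 < e0 & forall e D, 0 < e -> e <= e0 -> 0 < D ->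
    K * D `^ lambda < c / (2 * e) `^ gamma * D + e.
Proof.
move=> K0 c0 g0 /andP[l0 l1] qg; set q := (1 - lambda) / lambda.
have p0 : 0 < gamma - q by rewrite subr_gt0.
(* In these terms the two bounds combine to C <= e ^ (gamma - q); the factor 2
   in the choice of e0 makes this a strict contradiction. *)
set C := c * K^-1 `^ q / (K * 2 `^ gamma).
have C0 : 0 < C.
  by rewrite /C divr_gt0// mulr_gt0// powR_gt0// invr_gt0.
exists ((C / 2) `^ (gamma - q)^-1); first by rewrite powR_gt0// divr_gt0.
move=> e D e0 ee0 D0; rewrite ltNge; apply/negP => H.
have P0 : 0 < (2 * e) `^ gamma by rewrite powR_gt0// mulr_gt0.
have DE : D `^ lambda * D `^ (1 - lambda) = D.
  rewrite -powRD; last by rewrite (gt_eqF D0) implybT.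
  by rewrite addrC subrK powRr1// ltW.
have h1 : e <= K * D `^ lambda.
  apply: le_trans H; rewrite lerDr mulr_ge0// ?ltW// divr_gt0//.
have h2 : c * D `^ (1 - lambda) <= K * (2 * e) `^ gamma.
  have : c / (2 * e) `^ gamma * D <= K * D `^ lambda.
    by apply: le_trans H; rewrite lerDl ltW.
  rewrite mulrAC ler_pdivrMr// -{1}DE mulrCA.
  rewrite [leRHS]mulrAC [leRHS]mulrC ler_pM2l// powR_gt0//.
have h3 : (e / K) `^ q <= D `^ (1 - lambda).
  rewrite /q [_ / lambda]mulrC powRrM; apply: ge0_ler_powR => //.
  - by rewrite subr_ge0 ltW.
  - by rewrite nnegrE powR_ge0.
  - by rewrite nnegrE ltW.
  rewrite -[leRHS](powRr1 (ltW D0)) -(mulfV (lt0r_neq0 l0)) powRrM.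
  apply: ge0_ler_powR.
  - by rewrite invr_ge0 ltW.
  - by rewrite nnegrE divr_ge0// ltW.
  - by rewrite nnegrE powR_ge0.
  - by rewrite ler_pdivrMr// mulrC.
have h4 : C * e `^ q <= e `^ gamma.
  have : c * (e / K) `^ q <= K * (2 * e) `^ gamma.
    by apply: le_trans h2; rewrite ler_pM2l.
  have [eN KN] : 0 <= e /\ 0 <= K^-1 by rewrite invr_ge0 !ltW.
  rewrite !powRM// => h.
  rewrite /C mulrAC ler_pdivrMr ?mulr_gt0 ?powR_gt0//.
  rewrite (_ : _ * _ * _ = c * (e `^ q * K^-1 `^ q)); last by ring.
  by apply: le_trans h _; rewrite mulrA mulrC.
have h5 : C <= e `^ (gamma - q).
  rewrite powRB; last by rewrite (gt_eqF e0) implybT.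
  by rewrite ler_pdivlMr// powR_gt0.
have h6 : e `^ (gamma - q) <= C / 2.
  have C2 : 0 <= C / 2 by rewrite divr_ge0// ltW.
  rewrite -[leRHS](powRVK C2 (lt0r_neq0 p0)).
  have eN : e \in Num.nneg by rewrite nnegrE ltW.
  have rN : (C / 2) `^ (gamma - q)^-1 \in Num.nneg by rewrite nnegrE powR_ge0.
  exact: (ge0_ler_powR (ltW p0) eN rN ee0).
lra.
Qed.

Lemma continuous_lt_ball (R : realType) (x : R -> R) (r a : R) :
  {for r, continuous x} -> x r < a ->
  exists2 d, 0 < d & forall q, `|q - r| < d -> x q < a.
Proof.
move=> cx xra; have : \forall q \near r, x q < a by apply: (cvgr_lt _ cx).
by move=> /nbhs_ballP[d /= d0 H]; exists d => // q qr; apply: H;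
  rewrite /ball/= distrC.
Qed.

Lemma first_passage (R : realType) (x : R -> R) (S e : R) : continuous x ->
    0 <= S -> e < x 0 -> x S <= e ->
  exists t, [/\ 0 < t, t <= S, x t = e & forall r, 0 <= r <= t -> e <= x r].
Proof.
move=> cx S0 x0 xS.
set A := [set r | 0 <= r <= S /\ x r <= e].
have AS : A S by split=> //; rewrite S0 lexx.
have lA : lbound A 0 by move=> r [/andP[]].
have hA : has_inf A by split; [exists S | exists 0].
have t0 : 0 <= inf A by apply: lb_le_inf => //; exists S.
have tS : inf A <= S by apply: ge_inf => //; exists 0.
have before r : 0 <= r < inf A -> e < x r.
  move=> /andP[r0 rt]; rewrite ltNge; apply/negP => xr.
  have : A r by split=> //; rewrite r0 (le_trans (ltW rt)).
  by move=> /(ge_inf (ex_intro _ 0 lA)); rewrite leNgt rt.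
have xt : x (inf A) <= e.
  rewrite leNgt; apply/negP => ext.
  have cN : {for inf A, continuous (fun r => - x r)} by exact/continuousN/cx.
  have [|d d0 H] := @continuous_lt_ball _ _ _ (- e) cN; first by rewrite ltrN2.
  have [r [rS xr] rd] := inf_adherent d0 hA.
  have Ar : inf A <= r by apply: ge_inf => //; exists 0.
  have := H r; rewrite ger0_norm ?subr_ge0// ltrBlDl => /(_ rd).
  by rewrite ltrN2 ltNge xr.
have tp : 0 < inf A.
  by rewrite lt_neqAle t0 andbT; apply/eqP => Z; move: xt; rewrite -Z leNgt x0.
have xte : x (inf A) = e.
  apply/le_anti; rewrite xt/= leNgt; apply/negP => xlt.
  have [d d0 H] := continuous_lt_ball (cx (inf A)) xlt.
  have m0 : 0 < Order.min d (inf A) by rewrite lt_min d0.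
  have := H (inf A - Order.min d (inf A) / 2).
  rewrite addrAC subrr sub0r normrN gtr0_norm ?divr_gt0//.
  have md : Order.min d (inf A) <= d by rewrite ge_min lexx.
  have mi : Order.min d (inf A) <= inf A by rewrite ge_min lexx orbT.
  move=> /(_ _)/wrap[|]; first by lra.
  have := before (inf A - Order.min d (inf A) / 2).
  move=> /(_ _)/wrap[|]; first by lra.
  lra.
exists (inf A); split=> // r /andP[r0]; rewrite le_eqVlt => /predU1P[->|rt].
  by rewrite xte.
by apply/ltW/before; rewrite r0.
Qed.

(** The time t is the first passage of x at e; the time s, the last visit to
    2 * e before t, is obtained as the first passage of the reversed and
    reflected path 3 * e - x (t - .), which starts at 2 * e and has to come down
    to e. *)
Lemma final_descent (R : realType) (x : R -> R) (S e : R) : continuous x ->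
    0 <= S -> 0 < e -> 2 * e <= x 0 -> x S <= e ->
  exists s t, [/\ 0 <= s < t, t <= S, x s - x t = e,
    forall r, 0 <= r <= t -> e <= x r & forall r, s <= r <= t -> x r <= 2 * e].
Proof.
move=> cx S0 e0 x0 xS.
have [|t [t0 tS xt ge_e]] := first_passage cx S0 _ xS; first by lra.
have cy : continuous (fun r => 3 * e - x (t - r)).
  move=> r; apply: cvgB; first exact: cvg_cst.
  apply: (@continuous_comp _ _ _ (fun r => t - r) x); last exact: cx.
  by apply: cvgB; [exact: cvg_cst | exact: cvg_id].
have [||u [u0 ut xu le_2e]] := @first_passage _ _ t e cy (ltW t0).
- by rewrite subr0 xt; lra.
- by rewrite subrr; lra.
exists (t - u), t; split=> //; [by lra | by lra |].
move=> r /andP[sr rt]; have := le_2e (t - r).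
rewrite subKr => /(_ _)/wrap[|]; first by lra.
lra.
Qed.

(** * Paths on [0, T] as functions on the line *)

Section clamp.
Context (R : realType).

(** Composing a path on [0, T] with this retraction turns relative continuity
    on [0, T] into continuity on the whole line. *)
Definition clamp (T t : R) : R := Order.max 0 (Order.min T t).

Lemma clamp_itv (T t : R) : 0 <= T -> 0 <= clamp T t <= T.
Proof.
by move=> T0; rewrite /clamp le_max lexx ge_max T0 ge_min lexx.
Qed.

Lemma clamp_id (T t : R) : 0 <= t <= T -> clamp T t = t.
Proof. by move=> /andP[t0 tT]; rewrite /clamp min_r// max_r. Qed.

Lemma clamp_continuous (T : R) : continuous (clamp T).
Proof.
move=> t; apply: (@continuous_max _ _ (fun=> 0) (fun t => Order.min T t)).
  exact: cst_continuous.
apply: (@continuous_min _ _ (fun=> T) id); last exact: id.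
exact: cst_continuous.
Qed.

Lemma continuous_within_comp (X Y Z : topologicalType) (A : set Y)
    (f : Y -> Z) (g : X -> Y) :
  {within A, continuous f} -> continuous g -> (forall x, A (g x)) ->
  continuous (fun x => f (g x)).
Proof.
move=> cf cg Ag x; have /(_ _ (Ag x)) fgx := (subspace_continuousP _ _).1 cf.
apply: cvg_comp fgx => U; rewrite /within/= => UA.
have : \forall r \near x, A (g r) -> U (g r) by exact: cg UA.
by apply: filterS => r; apply.
Qed.

Lemma path_clamp_continuous (T : R) (f : R -> R) : 0 <= T ->
  continuous_path T f -> continuous (fun t => f (clamp T t)).
Proof.
move=> T0 cf; apply: continuous_within_comp cf _ _; first exact: clamp_continuous.
by move=> t /=; rewrite in_itv/= clamp_itv.
Qed.

End clamp.

Section hoelder.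
Context (R : realType).

(** The bound at the pair 0, T forces the sign of the constant. *)
Lemma hoelder_ge0 (T lambda K : R) (f : R -> R) : 0 < T ->
  hoelder_bound T lambda K f -> 0 <= K.
Proof.
move=> T0 /(_ 0 T); rewrite !lexx (ltW T0) => /(_ isT isT) h.
have := le_trans (normr_ge0 _) h.
by rewrite subr0 pmulr_lge0// powR_gt0// normr_gt0 gt_eqF.
Qed.

Lemma hoelder_continuous_path (T lambda K : R) (f : R -> R) : 0 < T ->
  0 < lambda -> hoelder_bound T lambda K f -> continuous_path T f.
Proof.
move=> T0 l0 hf; have K0 := hoelder_ge0 T0 hf.
apply/subspace_continuousP => s /=; rewrite in_itv/= => sT.
apply/cvgrPdist_lt => e e0.
pose d := (e / (K + 1)) `^ lambda^-1.
have eK : 0 < e / (K + 1) by rewrite divr_gt0// ltr_wpDl.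
have d0 : 0 < d by rewrite powR_gt0.
rewrite near_withinE /=; near=> t; rewrite in_itv/= => tT.
apply: le_lt_trans (hf t s tT sT) _.
have : `|s - t| `^ lambda <= e / (K + 1).
  rewrite -[leRHS](powRVK (ltW eK) (lt0r_neq0 l0)).
  suff sd : `|s - t| <= d.
    by apply: (ge0_ler_powR (ltW l0) _ _ sd); rewrite nnegrE// powR_ge0.
  by apply/ltW; near: t; exact: (@nbhsx_ballx R R s d d0).
rewrite ler_pdivlMr ?ltr_wpDl// => h.
have [->|] := eqVneq (`|s - t| `^ lambda) 0; first by rewrite mulr0.
move=> n0; apply: lt_le_trans h.
rewrite mulrC ltr_pM2l ?ltrDl// lt_neqAle eq_sym n0 powR_ge0//.
Unshelve. all: by end_near. Qed.

Lemma hoelder_boundB (T lambda K L : R) (f g : R -> R) :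
  hoelder_bound T lambda K f -> hoelder_bound T lambda L g ->
  hoelder_bound T lambda (K + L) (fun t => f t - g t).
Proof.
move=> hf hg s t sT tT; rewrite mulrDl.
rewrite (_ : _ - _ = (f t - f s) - (g t - g s)); last by ring.
by apply: le_trans (ler_normB _ _) _; rewrite lerD ?hf ?hg.
Qed.

Lemma hoelder_bound_le (T lambda K L : R) (f : R -> R) : K <= L ->
  hoelder_bound T lambda K f -> hoelder_bound T lambda L f.
Proof.
by move=> KL hf s t sT tT; apply: le_trans (hf s t sT tT) _;
  rewrite ler_wpM2r// powR_ge0.
Qed.

End hoelder.

(** * The barrier argument *)

Section lower_bound.
Context (R : realType) (T : R) (phi : R -> R) (b : R * R -> R).
Context (ystar c gamma : R).
Hypothesis T0 : 0 <= T.
Hypothesis cphi : continuous_path T phi.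
Hypothesis hA3 : drift_A3 T phi b ystar c gamma.

(** The equation is demanded only at times up to which the gap is at least e:
    this is what makes the lemma apply both to local solutions, which are known
    to satisfy it only before the hitting time, and to solutions of the equation
    with frozen drift, which coincide with solutions only there. *)
Lemma solution_gap (lambda K e Y0 : R) (z y : R -> R) :
    hoelder_bound T lambda K (fun t => z t - phi t) ->
    (forall D, 0 < D -> K * D `^ lambda < c / (2 * e) `^ gamma * D + e) ->
    0 < e -> 2 * e <= ystar -> 2 * e <= Y0 - phi 0 ->
    continuous_path T y -> y 0 = Y0 ->
    (forall t, 0 <= t <= T -> (forall r, 0 <= r <= t -> e <= y r - phi r) ->
      equation_at b Y0 z y t) ->
  forall t, 0 <= t <= T -> phi t + e < y t.
Proof.
move=> hzphi slope e0 estar eY0 cy y0 eqy S ST; rewrite ltNge; apply/negP => yS.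
have [_ c0 gamma0 bge] := hA3.
pose x r := y (clamp T r) - phi (clamp T r).
have xE r : 0 <= r <= T -> x r = y r - phi r by move=> ?; rewrite /x clamp_id.
have cx : continuous x.
  by move=> r; apply: continuousB; exact: path_clamp_continuous.
have T00 : 0 <= (0 : R) <= T by rewrite lexx.
have [S0 ST'] := andP ST.
have [||s [t [/andP[s0 st] tS xst xge xle]]] := @final_descent _ x S e cx S0 e0.
- by rewrite xE// y0.
- by rewrite xE// lerBlDl.
have tT : t <= T by exact: le_trans tS ST'.
have t0 : 0 <= t by rewrite (le_trans s0)// ltW.
have gap r : 0 <= r <= t -> e <= y r - phi r.
  by move=> /andP[r0 rt]; rewrite -xE ?xge ?r0//= (le_trans rt).
have [it yt] : equation_at b Y0 z y t by apply: eqy => //; rewrite t0.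
have [_ ys] : equation_at b Y0 z y s.
  apply: eqy; first by rewrite s0 (le_trans (ltW st)).
  by move=> r /andP[r0 rs]; apply: gap; rewrite r0 (le_trans rs)// ltW.
have drift r : s <= r <= t -> c / (2 * e) `^ gamma <= b (r, y r).
  move=> /andP[sr rt]; have r0 : 0 <= r by exact: le_trans sr.
  have rT : 0 <= r <= T by rewrite r0 (le_trans rt).
  have gr : e <= y r - phi r by apply: gap; rewrite r0.
  have gr' : y r - phi r <= 2 * e by rewrite -xE ?xle ?sr.
  apply: le_trans (bge r (y r) _); last first.
    by split; rewrite /dom/=; [split=> // | move=> []] ; lra.
  rewrite ler_pM2l// lef_pV2 ?posrE ?powR_gt0//; [|lra..].
  by apply: ge0_ler_powR; rewrite ?nnegrE ?(ltW gamma0)//; lra.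
have incr := Rintegral_incr_ge s0 (ltW st) it drift.
have sT : 0 <= s <= T by rewrite s0 (le_trans (ltW st)).
have tT' : 0 <= t <= T by rewrite t0.
have := hzphi s t sT tT'; rewrite (gtr0_norm (_ : 0 < t - s)) ?subr_gt0//.
move=> /ler_normlP[hz _].
have := slope (t - s); rewrite subr_gt0 => /(_ st).
move: xst; rewrite !xE// ys yt; lra.
Qed.

End lower_bound.

(** * Contraction in an exponentially weighted norm and uniqueness *)

Section uniqueness.
Context (R : realType).
Notation mu := (@lebesgue_measure R).

Lemma continuous_integrable (f : R -> R) (a t : R) : continuous f ->
  mu.-integrable `[a, t] (EFin \o f).
Proof.
move=> cf; apply: continuous_compact_integrable; first exact: segment_compact.
exact: continuous_subspaceT.
Qed.

Lemma continuous_expRM (k : R) : continuous (fun s : R => expR (k * s)).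
Proof.
move=> s; apply: (@continuous_comp _ _ _ (fun s => k * s) expR).
  exact: mulrl_continuous.
exact: continuous_expR.
Qed.

Lemma Rintegral_expR (k t : R) : k != 0 -> 0 <= t ->
  \int[mu]_(s in `[0, t]) expR (k * s) = (expR (k * t) - 1) / k.
Proof.
move=> k0; rewrite le_eqVlt => /predU1P[<-|t0].
  by rewrite set_itv1 Rintegral_set1 mulr0 expR0 subrr mul0r.
rewrite /Rintegral (@continuous_FTC2 _ _ (fun s => expR (k * s) / k))//=.
- by rewrite mulr0 expR0 mulrBl.
- exact/continuous_subspaceT/continuous_expRM.
- have cF : continuous (fun s : R => expR (k * s) / k).
    by move=> s; apply: cvgMl; exact: continuous_expRM.
  split.
  + by move=> s _; exact: ex_derive.
  + exact/cvg_at_right_filter/cF.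
  + exact/cvg_at_left_filter/cF.
- move=> s _; rewrite derive1E derive_val /=.
  by rewrite /GRing.scale/= mulr1; field.
Qed.

(** The weight expR (2 * L * s) is tuned so that integrating it against the
    Lipschitz constant L gains a factor 1/2.  Both uniqueness and the convergence
    of the Picard iterates rest on this gain. *)
Lemma Rintegral_exp_bound (f : R -> R) (L M t : R) : 0 < L -> 0 <= M -> 0 <= t ->
    mu.-integrable `[0, t] (EFin \o f) ->
    (forall s, 0 <= s <= t -> `|f s| <= L * M * expR (2 * L * s)) ->
  `|\int[mu]_(s in `[0, t]) f s| <= M / 2 * expR (2 * L * t).
Proof.
move=> L0 M0 t0 fi fb.
have ie : mu.-integrable `[0, t] (EFin \o (fun s => expR (2 * L * s))).
  exact/continuous_integrable/continuous_expRM.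
apply: le_trans (le_normr_Rintegral _ fi) _ => //.
apply: (@le_trans _ _ (\int[mu]_(s in `[0, t]) (L * M * expR (2 * L * s)))).
  apply: le_Rintegral => //=; first exact: integrable_norm.
  by apply: continuous_integrable => s; apply: cvgMr; exact: continuous_expRM.
rewrite RintegralZl// Rintegral_expR//; last by rewrite mulf_neq0// gt_eqF.
rewrite (_ : _ * _ = M / 2 * (expR (2 * L * t) - 1)); last by field; rewrite gt_eqF.
by rewrite ler_wpM2l ?divr_ge0// gerBl.
Qed.

Lemma positive_min (T : R) (x : R -> R) : 0 <= T -> continuous_path T x ->
  (forall t, 0 <= t <= T -> 0 < x t) ->
  exists2 e, 0 < e & forall t, 0 <= t <= T -> e < x t.
Proof.
move=> T0 cx xp; have [t tT tmin] := EVT_min T0 cx.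
move: tT; rewrite in_itv/= => /xp xt.
exists (x t / 2); first by rewrite divr_gt0.
by move=> s sT; have := tmin s; rewrite in_itv/= => /(_ sT); lra.
Qed.

(** The maximum of |y - y'| in the weighted norm is at most half of itself. *)
Lemma solution_path_unique (T : R) (phi : R -> R) (b : R * R -> R) (Y0 : R)
    (z y y' : R -> R) :
    0 <= T -> continuous_path T phi -> drift_A2 T phi b ->
    solution_path T phi b Y0 z y -> solution_path T phi b Y0 z y' ->
  forall t, 0 <= t <= T -> y t = y' t.
Proof.
move=> T0 cphi hA2 [cy hy] [cy' hy'].
have away (w : R -> R) : continuous_path T w ->
    (forall t, 0 <= t <= T -> dom T phi 0 (t, w t)) ->
    exists2 e, 0 < e & forall t, 0 <= t <= T -> phi t + e < w t.
  move=> cw hw; have [|t tT|e e0 he] := @positive_min T (fun t => w t - phi t) T0.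
  - by move=> t; apply: continuousB; [exact: cw | exact: cphi].
  - by have [_] := hw t tT; rewrite /= addr0 subr_gt0.
  - by exists e => // t /he; rewrite ltrBrDl.
have [|e e0 he] := away y cy; first by move=> t /hy[].
have [|e' e'0 he'] := away y' cy'; first by move=> t /hy'[].
have ee0 : 0 < Order.min e e' by rewrite lt_min e0.
have [L L0 lip] := hA2 _ ee0.
have domy t : 0 <= t <= T -> dom T phi (Order.min e e') (t, y t).
  move=> tT; split=> //=; apply: le_lt_trans (he t tT).
  by rewrite lerD2l ge_min lexx.
have domy' t : 0 <= t <= T -> dom T phi (Order.min e e') (t, y' t).
  move=> tT; split=> //=; apply: le_lt_trans (he' t tT).
  by rewrite lerD2l ge_min lexx orbT.
pose u t := `|y t - y' t| * expR (- (2 * L) * t).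
have cu : {within `[0, T], continuous u}.
  move=> t; apply: (@continuousM R (subspace `[0, T]) (fun t => `|y t - y' t|)
    (fun t => expR (- (2 * L) * t)) t).
    by apply: cvg_norm; apply: cvgB; [exact: cy | exact: cy'].
  exact/continuous_subspaceT/continuous_expRM.
have [m mT umax] := EVT_max T0 cu.
have uE t : `|y t - y' t| = u t * expR (2 * L * t).
  by rewrite /u -mulrA -expRD mulNr addNr expR0 mulr1.
have u0 t : 0 <= u t by rewrite mulr_ge0// expR_ge0.
have half t : 0 <= t <= T -> u t <= u m / 2.
  move=> tT; have [t0 tT'] := andP tT.
  have [_ [it Ey]] := hy t tT; have [_ [it' Ey']] := hy' t tT.
  rewrite -(ler_pM2r (expR_gt0 (2 * L * t))) -uE Ey Ey'.
  rewrite (_ : _ - _ = \int[mu]_(s in `[0, t]) b (s, y s)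
     - \int[mu]_(s in `[0, t]) b (s, y' s)); last by ring.
  rewrite -RintegralB//; apply: Rintegral_exp_bound => //.
    have := @integrableB _ _ _ mu `[0, t] (measurable_itv _) _ _ it it'.
    by apply: eq_integrable.
  move=> s /andP[s0 st]; have sT : 0 <= s <= T by rewrite s0 (le_trans st).
  apply: le_trans (lip s _ _ (domy s sT) (domy' s sT)) _.
  by rewrite -mulrA ler_pM2l// uE ler_pM2r ?expR_gt0// umax// in_itv.
have um : u m = 0.
  by move: mT; rewrite in_itv/= => /half; have := u0 m; lra.
move=> t tT; apply/eqP; rewrite -subr_eq0 -normr_eq0 uE.
by rewrite (_ : u t = 0) ?mul0r//; have := half t tT; have := u0 t; lra.
Qed.

End uniqueness.

(** * Riemann sums and measurability of integrals *)

Section riemann.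
Context (R : realType).
Notation mu := (@lebesgue_measure R).

(** Compactness of the segment in its near-covering form, with the modulus of
    continuity as the parameter tending to 0. *)
Lemma segment_unif_continuous (g : R -> R) (t e : R) : continuous g -> 0 < e ->
  exists2 d, 0 < d & forall x z, 0 <= x <= t -> `|z - x| < d -> `|g z - g x| < e.
Proof.
move=> cg e0.
pose P (d x : R) := forall z, `|z - x| < d -> `|g z - g x| < e.
have [d [d0 dP]] : exists d, 0 < d /\ `[0, t]%classic `<=` P d.
  have : \forall d \near 0^'+, `[0, t]%classic `<=` P d.
    have /compact_near_coveringP cov := @segment_compact R 0 t.
    apply: cov => x _.
    have /cvgrPdist_lt/(_ _ (divr_gt0 e0 (ltr0Sn R 1))) := cg x.
    move=> /nbhs_ballP[r /= r0 rP].
    exists (ball x (r / 2), [set d | d < r / 2]) => /=.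
      split; first by apply: nbhsx_ballx; rewrite divr_gt0.
      by apply: nbhs_right_lt; rewrite divr_gt0.
    move=> [x' d] [/= xx' dr] z zx'.
    have b1 : `|x - x'| < r / 2 by exact: xx'.
    have h1 := rP x' _; have h2 := rP z _.
    have {}h1 : `|g x - g x'| < e / 2 by apply: h1; rewrite /ball/=; lra.
    have {}h2 : `|g x - g z| < e / 2.
      apply: h2; rewrite /ball/= -(subrKA x').
      by apply: le_lt_trans (ler_normD _ _) _; rewrite (distrC x'); lra.
    rewrite -(subrKA (g x)).
    by apply: le_lt_trans (ler_normD _ _) _; rewrite (distrC (g z)); lra.
  move=> H; near (0 : R)^'+ => d; exists d; split; first by near: d; exact: nbhs_right_gt.
  by near: d.
by exists d => // x z xt; apply: dP; rewrite /= in_itv.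
Unshelve. all: by end_near. Qed.

(** On each cell the integral differs from its Riemann term by at most the
    oscillation of g there times the length of the cell, and these errors are
    summed along the cells. *)
Lemma riemann_sum_cvg (g : R -> R) (t : R) : 0 <= t -> continuous g ->
  (fun N : nat => \sum_(i < N.+1) t / N.+1%:R * g (i%:R * (t / N.+1%:R)))
    @ \oo --> \int[mu]_(s in `[0, t]) g s.
Proof.
move=> t0 cg; apply/cvgrPdist_le => e e0.
have eta0 : 0 < e / (t + 1) by rewrite divr_gt0// ltr_wpDl.
have [d d0 gd] := segment_unif_continuous t cg eta0.
near=> N; set h := t / N.+1%:R.
have h0 : 0 <= h by rewrite divr_ge0.
have hd : h < d.
  rewrite /h ltr_pdivrMr// mulrC -ltr_pdivrMr//.
  apply: lt_trans (_ : N%:R < _); last by rewrite ltr_nat.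
  by near: N; exact: nbhs_infty_gtr.
have steps k : (k <= N.+1)%N -> `|\int[mu]_(s in `[0, k%:R * h]) g s
    - \sum_(i < k) h * g (i%:R * h)| <= k%:R * h * (e / (t + 1)).
  elim: k => [|k IH] kN.
    by rewrite mul0r set_itv1 Rintegral_set1 big_ord0 subrr normr0 mul0r.
  have kh0 : 0 <= k%:R * h by rewrite mulr_ge0.
  have khS : k%:R * h <= k.+1%:R * h by rewrite ler_wpM2r// ler_nat.
  have kht : k%:R * h <= t.
    rewrite /h mulrA ler_pdivrMr// mulrC ler_wpM2l// ler_nat.
    exact: ltnW.
  have osc s : k%:R * h <= s <= k.+1%:R * h ->
      `|g s - g (k%:R * h)| < e / (t + 1).
    move=> /andP[ks sk]; apply: gd; first by rewrite kh0.
    rewrite ger0_norm ?subr_ge0//; apply: le_lt_trans hd.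
    by move: sk; rewrite -natr1; lra.
  have ig : mu.-integrable `[0, k.+1%:R * h] (EFin \o g).
    exact: continuous_integrable.
  have lo := @Rintegral_incr_ge R g _ _ (g (k%:R * h) - e / (t + 1)) kh0 khS ig.
  have hi := @Rintegral_incr_le R g _ _ (g (k%:R * h) + e / (t + 1)) kh0 khS ig.
  have {}lo := lo _; have {}hi := hi _.
  move: lo hi => /(_ _)/wrap[|lo].
    by move=> s /osc/ltr_normlP[]; lra.
  move=> /(_ _)/wrap[|hi].
    by move=> s /osc/ltr_normlP[]; lra.
  move: (IH (ltnW kN)) lo hi => /ler_normlP[l1 l2].
  rewrite big_ord_recr/=; set J := \int[mu]_(s in `[0, k.+1%:R * h]) g s.
  by rewrite -natr1 => lo hi; apply/ler_normlP; split; lra.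
have := steps _ (leqnn _); rewrite mulrC divfK//.
move/le_trans; apply.
by rewrite mulrCA ger_pMr// ler_pdivrMr ?mul1r ?lerDl ?ltr_wpDl.
Unshelve. all: by end_near. Qed.

(** A Riemann sum involves finitely many times only, so measurability passes
    from the fixed times to the sums and from the sums to their limit. *)
Lemma measurable_Rintegral (d : measure_display) (Omega : measurableType d)
    (g : Omega -> R -> R) (t : R) : 0 <= t ->
    (forall w, continuous (g w)) ->
    (forall s, measurable_fun setT (fun w => g w s)) ->
  measurable_fun setT (fun w => \int[mu]_(s in `[0, t]) g w s).
Proof.
move=> t0 cg mg.
pose S (N : nat) w := \sum_(i < N.+1) t / N.+1%:R * g w (i%:R * (t / N.+1%:R)).
apply: (@measurable_fun_cvg _ _ _ _ S) => [N|w _].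
  by apply: measurable_sum => i; apply: measurable_funM.
exact: riemann_sum_cvg.
Qed.

End riemann.

(** * Picard iteration for a globally Lipschitz drift *)

Section geometric.
Context (R : realType).

Lemma geometric_small (C e : R) : 0 < e -> \forall n \near \oo, C / 2 ^+ n < e.
Proof.
move=> e0; have /cvgr_lt : (fun n => C * 2^-1 ^+ n) @ \oo --> (C * 0 : R).
  apply: cvgMr; apply: cvg_expr.
  by rewrite ger0_norm ?invf_lt1 ?invr_ge0// ltr1n.
by rewrite mulr0 => /(_ e e0); apply: filterS => n; rewrite exprVn.
Qed.

(** The rate is part of the conclusion because it is uniform in any parameter on
    which u depends: this gives the continuity of the Picard limit. *)
Lemma geometric_cvg (u : nat -> R) (M : R) :
    (forall n, `|u n.+1 - u n| <= M / 2 ^+ n) ->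
  u @ \oo --> lim (u @ \oo) /\ forall n, `|lim (u @ \oo) - u n| <= 2 * M / 2 ^+ n.
Proof.
move=> du.
have M0 : 0 <= M by have := le_trans (normr_ge0 _) (du 0%N); rewrite expr0 divr1.
have p0 n : 0 < 2 ^+ n :> R by rewrite exprn_gt0.
have inc n k : `|u (n + k)%N - u n| <= 2 * M / 2 ^+ n - 2 * M / 2 ^+ (n + k).
  elim: k => [|k IH]; first by rewrite addn0 !subrr normr0.
  have step := du (n + k)%N.
  have -> : 2 * M / 2 ^+ (n + k.+1) = M / 2 ^+ (n + k) :> R.
    by rewrite addnS exprS invfM; field; rewrite gt_eqF.
  rewrite addnS -(subrKA (u (n + k)%N)).
  apply: le_trans (ler_normD _ _) _; rewrite -mulrA in IH *.
  by move: IH step; rewrite -!mulrA; lra.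
have inc' n m : (n <= m)%N -> `|u m - u n| <= 2 * M / 2 ^+ n.
  move=> nm; rewrite -(subnKC nm); apply: le_trans (inc _ _) _.
  by rewrite gerBl divr_ge0// ?mulr_ge0// ltW.
have cu : cvg (u @ \oo).
  apply/cauchy_cvgP/cauchy_exP => e e0.
  have [N _ HN] := geometric_small (2 * M) e0; exists (u N).
  exists N => // m /= Nm; rewrite /ball/= distrC.
  by apply: le_lt_trans (HN N (leqnn N)); exact: inc'.
split=> // n; have cn : `|u m - u n| @[m --> \oo] --> `|lim (u @ \oo) - u n|.
  by apply: cvg_norm; apply: cvgB => //; exact: cvg_cst.
rewrite -(cvg_lim _ cn)//; apply: limr_le; first by apply/cvg_ex; eexists; exact: cn.
by near=> m; apply: inc'; near: m; exact: nbhs_infty_ge.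
Unshelve. all: by end_near. Qed.

End geometric.

Section picard.
Context (R : realType) (T L : R) (B : R -> R -> R) (Y0 : R).
Notation mu := (@lebesgue_measure R).
Hypothesis T0 : 0 <= T.
Hypothesis L0 : 0 < L.
Hypothesis B_continuous : forall y, continuous y -> continuous (fun s => B s (y s)).
Hypothesis B_lip : forall s y1 y2, `|B s y1 - B s y2| <= L * `|y1 - y2|.

(** The upper limit of integration is clamped so that iterates are defined, and
    continuous, on the whole line. *)
Definition picard_step (z y : R -> R) (t : R) : R :=
  Y0 + \int[mu]_(s in `[0, clamp T t]) B s (y s) + z t.

Definition picard (z : R -> R) (n : nat) : R -> R :=
  iter n (picard_step z) (fun=> Y0).

Definition picard_lim (z : R -> R) (t : R) : R := lim (picard z n t @[n --> \oo]).

Lemma picard_continuous (z : R -> R) n : continuous z -> continuous (picard z n).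
Proof.
move=> cz; elim: n => [|n IH] /=; first exact: cst_continuous.
move=> t; apply: cvgD; last exact: cz.
apply: cvgD; first exact: cvg_cst.
pose I t := \int[mu]_(s in `[0, t]) B s (picard z n s).
have cI : continuous_path T I.
  apply: parameterized_integral_continuous => //.
  exact/continuous_integrable/B_continuous.
exact: (path_clamp_continuous T0 cI).
Qed.

Lemma picard_measurable (d : measure_display) (Omega : measurableType d)
    (Z : Omega -> R -> R) n t :
  (forall w, continuous (Z w)) -> (forall t, measurable_fun setT (fun w => Z w t)) ->
  measurable_fun setT (fun w => picard (Z w) n t).
Proof.
move=> cZ mZ; elim: n t => [|n IH] t /=; first exact: measurable_cst.
apply: measurable_funD; last exact: mZ.
apply: measurable_funD; first exact: measurable_cst.
apply: measurable_Rintegral => [|w|s].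
- by have /andP[] := clamp_itv t T0.
- by apply: B_continuous; exact: picard_continuous.
- apply: measurableT_comp; last exact: IH.
  apply: continuous_measurable_fun => y; apply/cvgrPdist_lt => e e0.
  have eL : 0 < e / L by rewrite divr_gt0.
  near=> y'; apply: le_lt_trans (B_lip _ _ _) _.
  rewrite mulrC -ltr_pdivlMr//; near: y'.
Unshelve. all: by end_near. Qed.

Section convergence.
Variable z : R -> R.
Hypothesis cz : continuous z.
Hypothesis zE : forall t, z (clamp T t) = z t.

Lemma picard_clamp n t : picard z n (clamp T t) = picard z n t.
Proof.
by case: n => [//|n] /=; rewrite /picard_step zE (clamp_id (clamp_itv t T0)).
Qed.

Lemma picard_integrable (y : R -> R) t : continuous y ->
  mu.-integrable `[0, t] (EFin \o (fun s => B s (y s))).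
Proof. by move=> cy; exact/continuous_integrable/B_continuous. Qed.

Lemma picard_step_contract (y y' : R -> R) (M t : R) :
    continuous y -> continuous y' -> 0 <= M -> 0 <= t <= T ->
    (forall s, 0 <= s <= T -> `|y s - y' s| <= M * expR (2 * L * s)) ->
  `|picard_step z y t - picard_step z y' t| <= M / 2 * expR (2 * L * t).
Proof.
move=> cy cy' M0 tT yy'; have [t0 tT'] := andP tT.
rewrite /picard_step clamp_id//.
rewrite (_ : _ - _ = \int[mu]_(s in `[0, t]) B s (y s)
   - \int[mu]_(s in `[0, t]) B s (y' s)); last by ring.
have [iy iy'] := (picard_integrable t cy, picard_integrable t cy').
rewrite -RintegralB//; apply: Rintegral_exp_bound => //.
  have := @integrableB _ _ _ mu `[0, t] (measurable_itv _) _ _ iy iy'.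
  by apply: eq_integrable.
move=> s /andP[s0 st]; apply: le_trans (B_lip _ _ _) _.
by rewrite -mulrA ler_pM2l// yy'// s0 (le_trans st).
Qed.

(** Successive differences are bounded by M * 2 ^ (- n) in the weighted norm,
    where M is the maximum of the first difference. *)
Lemma picard_cvg : exists2 M, 0 <= M & forall t,
  picard z n t @[n --> \oo] --> picard_lim z t /\
  forall n, `|picard_lim z t - picard z n t| <= M / 2 ^+ n.
Proof.
have cd : {within `[0, T], continuous (fun t => `|picard z 1 t - picard z 0 t|)}.
  apply: continuous_subspaceT => t; apply: cvg_norm.
  by apply: cvgB; exact: picard_continuous.
have [m mT mmax] := EVT_max T0 cd.
set M := `|picard z 1 m - picard z 0 m| in mmax.
have M0 : 0 <= M by exact: normr_ge0.
have e1 t : 0 <= t -> 1 <= expR (2 * L * t).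
  by move=> t0; rewrite -expR0 ler_expR !mulr_ge0// ltW.
have contr n t : 0 <= t <= T ->
    `|picard z n.+1 t - picard z n t| <= M / 2 ^+ n * expR (2 * L * t).
  elim: n t => [|n IH] t tT.
    rewrite expr0 divr1; apply: (@le_trans _ _ M); first by apply: mmax; rewrite in_itv.
    by rewrite ler_peMr// e1//; case/andP: tT.
  rewrite exprSr invfM [in leRHS]mulrA.
  have q0 : 0 <= M / 2 ^+ n by rewrite divr_ge0// exprn_ge0.
  have cp k : continuous (picard z k) by exact: picard_continuous.
  exact: (picard_step_contract (cp n.+1) (cp n) q0 tT IH).
pose M' := M * expR (2 * L * T).
exists (2 * M'); first by rewrite !mulr_ge0// expR_ge0.
move=> t; apply: geometric_cvg => n.
rewrite -(picard_clamp n.+1) -(picard_clamp n).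
have tT := clamp_itv t T0; have [_ tT'] := andP tT.
apply: le_trans (contr n _ tT) _; rewrite /M' mulrAC ler_pM2r ?invr_gt0 ?exprn_gt0//.
by rewrite ler_wpM2l// ler_expR ler_pM2l// mulr_gt0.
Qed.

Lemma picard_lim_continuous : continuous (picard_lim z).
Proof.
have [M M0 MP] := picard_cvg.
move=> t; apply/cvgrPdist_lt => e e0.
have [n Mn] : exists n, M / 2 ^+ n < e / 3.
  have e3 : 0 < e / 3 by rewrite divr_gt0.
  by have [N _ HN] := geometric_small M e3; exists N; exact: HN (leqnn N).
have e3 : 0 < e / 3 by rewrite divr_gt0.
have /cvgrPdist_lt/(_ _ e3) near_t := @picard_continuous z n cz t.
near=> s.
have h1 := (MP t).2 n; have := (MP s).2 n; rewrite distrC => h2.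
have h3 : `|picard z n t - picard z n s| < e / 3 by near: s.
rewrite (_ : _ - _ = (picard_lim z t - picard z n t)
  + (picard z n t - picard z n s) + (picard z n s - picard_lim z s)); last by ring.
apply: le_lt_trans (ler_normD _ _) _.
have := ler_normD (picard_lim z t - picard z n t) (picard z n t - picard z n s).
lra.
Unshelve. all: by end_near. Qed.

(** The step operator contracts, so it carries the iterates, which converge to
    the limit uniformly, to its value at the limit. *)
Lemma picard_lim_fixpoint t : 0 <= t <= T ->
  picard_lim z t = Y0 + \int[mu]_(s in `[0, t]) B s (picard_lim z s) + z t.
Proof.
move=> tT; have [M M0 MP] := picard_cvg; have [t0 tT'] := andP tT.
have -> : Y0 + \int[mu]_(s in `[0, t]) B s (picard_lim z s) + z t
  = picard_step z (picard_lim z) t by rewrite /picard_step clamp_id.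
have lim1 : picard z n.+1 t @[n --> \oo] --> picard_lim z t.
  by have [] := MP t; rewrite (cvg_shiftS (fun n => picard z n t)).
apply: (cvg_unique _ lim1) => //.
apply/cvgrPdist_lt => e e0; pose C := M * expR (2 * L * T).
have C0 : 0 <= C by rewrite mulr_ge0// expR_ge0.
have := geometric_small C e0; apply: filterS => n Cn; apply: le_lt_trans Cn.
apply: le_trans (picard_step_contract (M := M / 2 ^+ n) _ _ _ tT _) _.
- exact: picard_lim_continuous.
- exact: picard_continuous.
- by rewrite divr_ge0// exprn_ge0.
- move=> s /andP[s0 sT]; apply: le_trans ((MP s).2 n) _.
  by rewrite ler_peMr ?divr_ge0 ?exprn_ge0// -expR0 ler_expR !mulr_ge0// ltW.
- rewrite /C mulrAC [in leRHS]mulrAC.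
  have eT : expR (2 * L * t) <= expR (2 * L * T).
    by rewrite ler_expR ler_pM2l// mulr_gt0.
  have q0 : 0 <= M / 2 ^+ n by rewrite divr_ge0// exprn_ge0.
  have ex := expR_ge0 (2 * L * t).
  have := ler_wpM2l q0 eT; have := mulr_ge0 q0 ex.
  lra.
Qed.

End convergence.
End picard.

(** * Freezing the drift near the barrier *)

Section truncated_drift.
Context (R : realType) (T : R) (phi : R -> R) (b : R * R -> R).
Hypothesis T0 : 0 <= T.
Hypothesis cphi : continuous_path T phi.
Hypothesis hA1 : drift_A1 T phi b.
Hypothesis hA2 : drift_A2 T phi b.

(** The drift is frozen below phi + e, so that it is evaluated only at distance
    at least e from the barrier, where it is Lipschitz. *)
Definition truncated_drift (e s y : R) : R :=
  b (clamp T s, Order.max y (phi (clamp T s) + e)).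

Lemma truncated_driftE e s y : 0 <= s <= T -> phi s + e <= y ->
  truncated_drift e s y = b (s, y).
Proof. by move=> sT le_y; rewrite /truncated_drift clamp_id// max_l. Qed.

Lemma truncated_drift_continuous e (y : R -> R) : 0 < e -> continuous y ->
  continuous (fun s => truncated_drift e s (y s)).
Proof.
move=> e0 cy; apply: (continuous_within_comp hA1) => [s|s].
  apply: (@cvg_pair _ _ _ (nbhs s) (nbhs (clamp T s))
    (nbhs (Order.max (y s) (phi (clamp T s) + e)))); first exact: clamp_continuous.
  apply: (@continuous_max _ _ y (fun s => phi (clamp T s) + e)); first exact: cy.
  apply: cvgD; last exact: cvg_cst.
  exact: (path_clamp_continuous T0 cphi).
by split; rewrite /= ?clamp_itv// lt_max ltrD2l e0 orbT.
Qed.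

(** The truncated argument may lie exactly on phi + e, which does not belong to
    the open domain at distance e; the constant is therefore taken from the
    domain at distance e / 2. *)
Lemma truncated_drift_lipschitz e : 0 < e -> exists2 L, 0 < L &
  forall s y1 y2,
    `|truncated_drift e s y1 - truncated_drift e s y2| <= L * `|y1 - y2|.
Proof.
move=> e0; have e2 : 0 < e / 2 by rewrite divr_gt0.
have [L L0 lip] := hA2 e2; exists L => // s y1 y2.
have domM y : dom T phi (e / 2) (clamp T s, Order.max y (phi (clamp T s) + e)).
  by split; rewrite /= ?clamp_itv// lt_max ltrD2l; apply/orP; right; lra.
apply: le_trans (lip _ _ _ (domM y1) (domM y2)) _.
have /ler_normlP[lo hi] := lexx `|y1 - y2|.
rewrite ler_pM2l// /Order.max.
by case: ifPn; case: ifPn; rewrite -?leNgt => ? ?; apply/ler_normlP; split; lra.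
Qed.

End truncated_drift.

(** * Solutions of the equation, path by path *)

Section pathwise.
Context (R : realType) (T lambda : R) (phi : R -> R) (b : R * R -> R).
Context (Y0 ystar c gamma Kphi : R).
Hypothesis T_gt0 : 0 < T.
Hypothesis lambda01 : 0 < lambda < 1.
Hypothesis hphi : hoelder_bound T lambda Kphi phi.
Hypothesis hY0 : phi 0 < Y0.
Hypothesis hA1 : drift_A1 T phi b.
Hypothesis hA2 : drift_A2 T phi b.
Hypothesis hA3 : drift_A3 T phi b ystar c gamma.
Hypothesis hA4 : drift_A4 lambda gamma.
Notation mu := (@lebesgue_measure R).

Let T_ge0 : 0 <= T := ltW T_gt0.

Let cphi : continuous_path T phi.
Proof. by have /andP[l0 _] := lambda01; exact: hoelder_continuous_path hphi. Qed.

(** The threshold e0 is chosen before y: along the approximating sequence below,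
    the level e and the solution y vary together while z stays fixed. *)
Lemma small_gap_solution (Lambda : R) (z : R -> R) : hoelder_bound T lambda Lambda z ->
  exists2 e0, 0 < e0 & forall e y, 0 < e -> e <= e0 ->
    continuous_path T y -> y 0 = Y0 ->
    (forall t, 0 <= t <= T -> (forall r, 0 <= r <= t -> e <= y r - phi r) ->
      equation_at b Y0 z y t) ->
    (forall t, 0 <= t <= T -> phi t < y t) /\ solution_path T phi b Y0 z y.
Proof.
move=> hz; have [st0 c0 g0 _] := hA3.
have K0 : 0 < Lambda + Kphi + 1.
  by rewrite ltr_wpDl// addr_ge0// (hoelder_ge0 T_gt0 hz, hoelder_ge0 T_gt0 hphi).
have hK : hoelder_bound T lambda (Lambda + Kphi + 1) (fun t => z t - phi t).
  by apply: hoelder_bound_le (hoelder_boundB hz hphi); rewrite lerDl.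
have [e1 e1_gt0 slope] := no_short_descent K0 c0 g0 lambda01 hA4.
exists (Order.min e1 (Order.min (ystar / 2) ((Y0 - phi 0) / 2))).
  by rewrite !lt_min e1_gt0 !divr_gt0// subr_gt0.
move=> e y e0; rewrite !le_min => /and3P[ee1 es eY] cy y0 eqy.
have gap : forall t, 0 <= t <= T -> phi t + e < y t.
  apply: (solution_gap T_ge0 cphi hA3 hK _ e0 _ _ cy y0 eqy).
  - by move=> D; exact: slope.
  - by lra.
  - by lra.
have above t : 0 <= t <= T -> phi t < y t.
  by move=> /gap; apply: lt_trans; rewrite ltrDl.
split=> //; split=> // t tT; split; first by split; rewrite //= addr0 above.
apply: eqy => // r /andP[r0 rt]; rewrite lerBrDl ltW// gap// r0 (le_trans rt)//.
by case/andP: tT.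
Qed.

Lemma tau0_ge (y : R -> R) (t : R) : t <= T ->
  (forall r, 0 <= r < t -> y r <> phi r) -> (t%:E <= tau0 T phi y)%E.
Proof.
move=> tT nr; rewrite /tau0 le_min lee_fin tT andbT.
apply: le_ereal_inf_tmp => _ [r [/andP[r0 rT] yr] <-]; rewrite lee_fin leNgt.
by apply/negP => rt; apply: (nr r) yr; rewrite r0.
Qed.

Lemma equation_at0 (z y : R -> R) : z 0 = 0 -> equation_at b Y0 z y 0 -> y 0 = Y0.
Proof. by move=> z0 [_ ->]; rewrite set_itv1 Rintegral_set1 z0 !addr0. Qed.

(** If the gap is at least e > 0 on [0, t], then t does not exceed the hitting
    time, so the equation holds at t and the barrier argument applies. *)
Lemma local_solution_above (Lambda : R) (z y : R -> R) :
    hoelder_bound T lambda Lambda z -> z 0 = 0 ->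
    local_solution_path T phi b Y0 z y ->
  (forall t, 0 <= t <= T -> phi t < y t) /\ solution_path T phi b Y0 z y.
Proof.
move=> hz z0 [cy hy]; have [e e0 H] := small_gap_solution hz.
apply: (H e) => //.
  apply: (equation_at0 z0); apply: hy; rewrite ?lexx//; apply: tau0_ge => // r.
  by move=> /andP[r0 /(le_lt_trans r0)]; rewrite ltxx.
move=> t /andP[t0 tT] gap; apply: hy => //; apply: tau0_ge => // r /andP[r0 rt] yr.
by have := gap r; rewrite r0 ltW// yr subrr => /(_ isT); rewrite leNgt e0.
Qed.

Definition truncated_solution (z : R -> R) (n : nat) (t : R) : R :=
  picard_lim T (truncated_drift T phi b n.+1%:R^-1) Y0 z t.

Definition truncated_solution_lim (z : R -> R) (t : R) : R := lim (truncated_solution z n t @[n --> \oo]).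

Let n1_gt0 n : 0 < n.+1%:R^-1 :> R. Proof. by rewrite invr_gt0. Qed.

(** As long as the gap is at least 1 / n.+1, the freezing of the drift is not
    felt and the original equation holds. *)
Lemma truncated_solution_spec (z : R -> R) n :
    continuous z -> (forall t, z (clamp T t) = z t) -> z 0 = 0 ->
  [/\ continuous (truncated_solution z n), truncated_solution z n 0 = Y0 &
    forall t, 0 <= t <= T ->
      (forall r, 0 <= r <= t -> n.+1%:R^-1 <= truncated_solution z n r - phi r) ->
      equation_at b Y0 z (truncated_solution z n) t].
Proof.
move=> cz zE z0; have [L L0 lip] := truncated_drift_lipschitz T_ge0 hA2 (n1_gt0 n).
have cB y := @truncated_drift_continuous R T phi b T_ge0 cphi hA1 _ y (n1_gt0 n).
have fixp t : 0 <= t <= T -> truncated_solution z n t = Y0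
    + \int[mu]_(s in `[0, t]) truncated_drift T phi b n.+1%:R^-1 s (truncated_solution z n s)
    + z t.
  exact: (picard_lim_fixpoint Y0 T_ge0 L0 cB lip).
have ca : continuous (truncated_solution z n) by exact: (picard_lim_continuous T_ge0 L0 cB lip).
split=> // [|t tT gap].
  by rewrite fixp ?lexx// set_itv1 Rintegral_set1 z0 !addr0.
have bE s : s \in `[0, t]%classic ->
    truncated_drift T phi b n.+1%:R^-1 s (truncated_solution z n s) = b (s, truncated_solution z n s).
  rewrite inE/= in_itv/= => /[dup] st /andP[s0 s_t]; apply: truncated_driftE.
    by rewrite s0 (le_trans s_t)//; case/andP: tT.
  by have := gap s st; rewrite lerBrDl.
split.
  have := continuous_integrable 0 t (cB _ ca).
  by apply: eq_integrable => // s st /=; rewrite bE.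
by rewrite [LHS]fixp//; congr (_ + _ + _); exact: eq_Rintegral.
Qed.

(** For large n the truncated solutions all solve the original equation, hence
    coincide by uniqueness. *)
Lemma truncated_solution_lim_spec (Lambda : R) (z : R -> R) :
    hoelder_bound T lambda Lambda z -> (forall t, z (clamp T t) = z t) -> z 0 = 0 ->
  (forall t, truncated_solution z n t @[n --> \oo] --> truncated_solution_lim z t) /\
  solution_path T phi b Y0 z (truncated_solution_lim z).
Proof.
move=> hz zE z0; have [l0 _] := andP lambda01.
have cz : continuous z.
  have := path_clamp_continuous T_ge0 (hoelder_continuous_path T_gt0 l0 hz).
  by rewrite (_ : (fun t => z _) = z)//; apply/funext.
have [e e0 H] := small_gap_solution hz.
have [N _ HN] : \forall n \near \oo, n.+1%:R^-1 < e.
  exact: (near_infty_natSinv_lt (PosNum e0)).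
have sol n : (N <= n)%N -> solution_path T phi b Y0 z (truncated_solution z n).
  move=> Nn; have [ca a0 aeq] := truncated_solution_spec n cz zE z0.
  have /ltW ne := HN n Nn.
  by have [] := H _ _ (n1_gt0 n) ne (continuous_subspaceT ca) a0 aeq.
have aE n t : truncated_solution z n (clamp T t) = truncated_solution z n t.
  rewrite /truncated_solution /picard_lim.
  by under eq_fun do rewrite (picard_clamp _ _ T_ge0 zE).
have aN n t : (N <= n)%N -> truncated_solution z n t = truncated_solution z N t.
  move=> Nn; rewrite -(aE n) -(aE N).
  apply: (solution_path_unique T_ge0 cphi hA2 (sol n Nn) (sol N (leqnn N))).
  exact: clamp_itv.
have acvg t : truncated_solution z n t @[n --> \oo] --> truncated_solution z N t.
  by apply: cvg_near_cst; exists N => // n /= Nn; rewrite aN.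
have limE : truncated_solution_lim z = truncated_solution z N.
  by apply/funext => t; apply/cvg_lim => //; exact: acvg.
by rewrite limE; split=> //; exact: sol.
Qed.

Lemma truncated_solution_measurable (d : measure_display) (Omega : measurableType d)
    (z : Omega -> R -> R) n t :
    (forall w, continuous (z w)) -> (forall w t, z w (clamp T t) = z w t) ->
    (forall t, measurable_fun setT (fun w => z w t)) ->
  measurable_fun setT (fun w => truncated_solution (z w) n t).
Proof.
move=> cz zE mz; have [L L0 lip] := truncated_drift_lipschitz T_ge0 hA2 (n1_gt0 n).
have cB y := @truncated_drift_continuous R T phi b T_ge0 cphi hA1 _ y (n1_gt0 n).
pose B := truncated_drift T phi b n.+1%:R^-1.
apply: (@measurable_fun_cvg _ _ _ _ (fun k w => picard T B Y0 (z w) k t)).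
  by move=> k; exact: (picard_measurable Y0 T_ge0 L0 cB lip).
move=> w _; have [M _ MP] := picard_cvg Y0 T_ge0 L0 cB lip (cz w) (zE w).
by have [] := MP t.
Qed.

End pathwise.

(** * The stochastic equation *)

Theorem theorem2p3 (R : realType) (d : measure_display)
    (Omega : measurableType d) (P : probability Omega R)
    (T lambda : R) (hT : 0 < T) (hlambda : 0 < lambda < 1)
    (phi : R -> R) (hphi : hoelder_continuous T lambda phi)
    (Y0 : R) (hY0 : phi 0 < Y0)
    (Z : R -> {RV P >-> R}) (hZ : noise T lambda Z)
    (b : R * R -> R) (ystar c gamma : R)
    (hA1 : drift_A1 T phi b) (hA2 : drift_A2 T phi b)
    (hA3 : drift_A3 T phi b ystar c gamma) (hA4 : drift_A4 lambda gamma) :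
  (forall Y : R -> {RV P >-> R}, local_solution T phi b Y0 Z Y ->
     {ae P, forall w, forall t, 0 <= t <= T -> phi t < Y t w} /\
     solution T phi b Y0 Z Y) /\
  (exists Y : R -> {RV P >-> R}, solution T phi b Y0 Z Y) /\
  (forall Y Y' : R -> {RV P >-> R},
     solution T phi b Y0 Z Y -> solution T phi b Y0 Z Y' ->
     indistinguishable T Y Y').
Proof.
have [Kphi hKphi] := hphi.
have [Z0 [Lambda _ hLambda]] := hZ.
have T_ge0 := ltW hT.
have T00 : 0 <= (0 : R) <= T by rewrite lexx.
split; [|split].
- move=> Y hY.
  have good : {ae P, forall w, (forall t, 0 <= t <= T -> phi t < Y t w) /\
      solution_path T phi b Y0 (fun t => Z t w) (fun t => Y t w)}.
    apply: filterS2 Z0 hY => w Z0w.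
    exact: (local_solution_above hT hlambda hKphi hY0 hA3 hA4 (hLambda w)).
  by split; apply: filterS good => w [].
(* Subtracting the initial value makes the construction valid for every w, and
   not only almost surely; the values outside [0, T] are frozen. *)
- pose z w t := Z (clamp T t) w - Z 0 w.
  have zE w t : z w (clamp T t) = z w t.
    by rewrite /z (clamp_id (clamp_itv t T_ge0)).
  have z0 w : z w 0 = 0 by rewrite /z (clamp_id T00) subrr.
  have hz w : hoelder_bound T lambda (Lambda w) (z w).
    move=> s t sT tT; rewrite /z !clamp_id// opprB addrA subrK.
    exact: hLambda.
  have cz w : continuous (z w).
    have [l0 _] := andP hlambda.
    have := path_clamp_continuous T_ge0 (hoelder_continuous_path hT l0 (hz w)).
    by rewrite (_ : (fun t => z w _) = z w)//; apply/funext.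
  have mz t : measurable_fun setT (fun w => z w t).
    by apply: measurable_funB.
  have sol w := truncated_solution_lim_spec hT hlambda hKphi hY0 hA1 hA2 hA3 hA4
    (hz w) (zE w) (z0 w).
  have mY t : measurable_fun setT (fun w => truncated_solution_lim T phi b Y0 (z w) t).
    apply: (@measurable_fun_cvg _ _ _ _ (fun n w => truncated_solution T phi b Y0 (z w) n t)).
      move=> n; exact: (truncated_solution_measurable Y0 hT hlambda hKphi hA1 hA2).
    by move=> w _; exact: (sol w).1.
  exists (fun t => mfun_Sub (mem_set (mY t)) : {RV P >-> R}).
  apply: filterS Z0 => w Z0w.
  suff : solution_path T phi b Y0 (fun t => Z t w) (truncated_solution_lim T phi b Y0 (z w)).
    exact.
  have [cY hY] := (sol w).2; split=> // t tT.
  have [dY [iY eY]] := hY t tT; split=> //; split=> //.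
  by rewrite {1}eY /z (clamp_id tT) Z0w subr0.
- move=> Y Y' hY hY'; apply: filterS2 hY hY' => w.
  apply: solution_path_unique => //.
  by have [l0 _] := andP hlambda; exact: hoelder_continuous_path hKphi.
Qed.
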